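(* Let $\beta\in\mathbb R$ be a constant, $1\le n\le 3$, $0<\alpha\le 1$, $\rho_\pm>0$, $u_\pm\in\mathbb R$, and suppose $u_->u_+$. For each fixed $A,B>0$, let $(\rho_+,u_+)\in\mathrm{IV}$, and assume that $(\rho^{AB},u^{AB})$ is the two-shock wave solution of the Riemann problem for the extended Chaplygin gas equations with Coulomb-like friction $$\rho_t+(\rho u)_x=0,\qquad (\rho u)_t+(\rho u^2+P)_x=\beta\rho,\qquad P=A\rho^n-\frac{B}{\rho^\alpha},$$ with initial data $(\rho,u)(x,0)=(\rho_\pm,u_\pm)$ for $\pm x>0$. Then, when $A,B\to0$, $(\rho^{AB},u^{AB})$ converges to a delta shock wave solution to the transportation equations $$\rho_t+(\rho u)_x=0,\qquad (\rho u)_t+(\rho u^2)_x=\beta\rho$$ with the same source term and the same initial data.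
   Context: Region $\mathrm{IV}$: put $v=u-\beta t$ and $P(\rho)=A\rho^n-B\rho^{-\alpha}$. In the half-plane $\rho>0$ of the $(\rho,v)$ phase plane, the shock curves through the left state $(\rho_-,u_-)$ are given by $v-u_-=-\sqrt{\frac{\rho-\rho_-}{\rho\rho_-}(P(\rho)-P(\rho_-))}$, with $\rho>\rho_-$ for the 1-shock curve and $\rho<\rho_-$ for the 2-shock curve. Region $\mathrm{IV}$ is the part of the half-plane lying to the left (smaller $v$) of these two curves; for right states in it the Riemann solution consists of a 1-shock followed by a 2-shock. Two-shock wave solution: $$(\rho^{AB},u^{AB})(x,t)=\begin{cases}(\rho_-,u_-+\beta t),&x<x_1^{AB}(t),\\(\rho_*^{AB},v_*^{AB}+\beta t),&x_1^{AB}(t)<x<x_2^{AB}(t),\\(\rho_+,u_++\beta t),&x>x_2^{AB}(t),\end{cases}$$ where the constants $\rho_*^{AB}>\max\{\rho_-,\rho_+\}$ and $v_*^{AB}$ are determined by $$v_*^{AB}-u_-=-\sqrt{\tfrac{\rho_*^{AB}-\rho_-}{\rho_*^{AB}\rho_-}(P(\rho_*^{AB})-P(\rho_-))},\qquad u_+-v_*^{AB}=-\sqrt{\tfrac{\rho_+-\rho_*^{AB}}{\rho_+\rho_*^{AB}}(P(\rho_+)-P(\rho_*^{AB}))},$$ and the shock curves start at $x=0$ with speeds $\frac{dx_1^{AB}}{dt}=\frac{\rho_*^{AB}v_*^{AB}-\rho_-u_-}{\rho_*^{AB}-\rho_-}+\beta t$ and $\frac{dx_2^{AB}}{dt}=\frac{\rho_+u_+-\rho_*^{AB}v_*^{AB}}{\rho_+-\rho_*^{AB}}+\beta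 t$. Delta shock wave solution of the transportation equations with friction (for $u_->u_+$): a solution of the form $$(\rho,u)(x,t)=\begin{cases}(\rho_-,u_-+\beta t),& x<x(t),\\ (w(t)\delta(x-x(t)),u_\delta(t)),& x=x(t),\\ (\rho_+,u_++\beta t),& x>x(t),\end{cases}$$ with $x(0)=0$, $w(0)=0$, $x'(t)=u_\delta(t)$, satisfying the entropy condition $u_++\beta t<u_\delta(t)<u_-+\beta t$ and, for all $\psi\in C_0^\infty(\mathbb R\times\mathbb R_+)$, $$\langle\rho,\psi_t\rangle+\langle\rho u,\psi_x\rangle=0,\qquad \langle\rho u,\psi_t\rangle+\langle\rho u^2,\psi_x\rangle=-\langle\beta\rho,\psi\rangle,$$ where $\langle\rho u^k,\psi\rangle=\int_0^\infty\!\int_{-\infty}^\infty \rho_0u_0^k\psi\,dx\,dt+\int_0^\infty w(t)u_\delta(t)^k\psi(x(t),t)\,dt$ for $k=0,1,2$, with $(\rho_0,u_0)=(\rho_-,u_-+\beta t)$ for $x<x(t)$ and $(\rho_+,u_++\beta t)$ for $x>x(t)$. It is given by $u_\delta(t)=\sigma_0+\beta t$, $x(t)=\sigma_0t+\frac12\beta t^2$, $w(t)=\sqrt{\rho_-\rho_+}(u_--u_+)t$, where $\sigma_0=\frac{\sqrt{\rho_-}u_-+\sqrt{\rho_+}u_+}{\sqrt{\rho_-}+\sqrt{\rho_+}}$. *)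

(* Defs.v *)
From HB Require Import structures.
From mathcomp Require Import all_boot all_order all_algebra.
From mathcomp Require Import all_classical all_reals all_analysis.

Set Implicit Arguments.
Unset Strict Implicit.
Unset Printing Implicit Defensive.

Import Order.TTheory GRing.Theory Num.Theory.
Import numFieldNormedType.Exports.

Local Open Scope classical_set_scope.
Local Open Scope ring_scope.

(* Densities and velocities are curried functions of (x, t); test functions
   take the pair (x, t). *)

(** * Test functions *)

Fixpoint Ck (R : realType) (k : nat) (f : R * R -> R) : Prop :=
  if k is k'.+1
  then (forall p, differentiable f p) /\ (forall v, Ck k' ('D_v f))
  else continuous f.

Definition supp (R : realType) (f : R * R -> R) : set (R * R) :=
  closure [set p | f p != 0].

(* C_0^oo (R x R_+) with R_+ = (0, +oo): supports avoid t = 0, so no term at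
   t = 0 appears in the weak formulations. Functions are extended by 0 to
   t <= 0. *)
Definition test_function (R : realType) (psi : R * R -> R) : Prop :=
  [/\ forall k, Ck k psi, compact (supp psi) &
      supp psi `<=` [set p | 0 < p.2]].

Definition dx (R : realType) (psi : R * R -> R) : R * R -> R :=
  'D_((1, 0) : R * R) psi.

Definition dt (R : realType) (psi : R * R -> R) : R * R -> R :=
  'D_((0, 1) : R * R) psi.

(** * The Riemann problem for a pressure law P *)

Definition pairing (R : realType) (f : R -> R -> R) (psi : R * R -> R) : R :=
  \int[lebesgue_measure]_(t in `]0, +oo[)
    \int[lebesgue_measure]_x (f x t * psi (x, t)).

Definition weak_solution (R : realType) (P : R -> R) (beta : R)
    (rho u : R -> R -> R) : Prop :=
  forall psi, test_function psi ->
    pairing rho (dt psi) + pairing (fun x t => rho x t * u x t) (dx psi) = 0 /\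
    pairing (fun x t => rho x t * u x t) (dt psi)
      + pairing (fun x t => rho x t * u x t ^+ 2 + P (rho x t)) (dx psi)
    = - pairing (fun x t => beta * rho x t) psi.

Definition riemann_solution (R : realType) (P : R -> R)
    (beta rl ul rr ur : R) (rho u : R -> R -> R) : Prop :=
  [/\ weak_solution P beta rho u,
      forall x, x < 0 -> rho x 0 = rl /\ u x 0 = ul &
      forall x, 0 < x -> rho x 0 = rr /\ u x 0 = ur].

(** * Extended Chaplygin gas *)

Definition pressure (R : realType) (A B n alpha rho : R) : R :=
  A * rho `^ n - B / rho `^ alpha.

Definition velocity_jump (R : realType) (P : R -> R) (r1 r2 : R) : R :=
  - Num.sqrt ((r2 - r1) / (r2 * r1) * (P r2 - P r1)).

(* The 1-shock curve is the graph of ul + velocity_jump P rl over rho > rl, the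
   2-shock curve its graph over 0 < rho < rl; they meet at (rl, ul), where the
   jump is 0. *)
Definition region_IV (R : realType) (P : R -> R) (rl ul : R) : set (R * R) :=
  [set q | 0 < q.1 /\ q.2 < ul + velocity_jump P rl q.1].

Definition shock_speed (R : realType) (r1 v1 r2 v2 : R) : R :=
  (r2 * v2 - r1 * v1) / (r2 - r1).

Definition path_from_0 (R : realType) (x s : R -> R) : Prop :=
  [/\ x 0 = 0, {within `[0, +oo[, continuous x} &
      forall t : R, 0 < t -> is_derive t 1 x (s t)].

(* (rs, vs) is the intermediate state, in the variables (rho, v) with
   v = u - beta * t; x1 and x2 are the shock curves, on which the values of
   rho and u are left unspecified. *)
Definition two_shock_solution (R : realType) (P : R -> R)
    (beta rl ul rr ur rs vs : R) (x1 x2 : R -> R) (rho u : R -> R -> R)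
    : Prop :=
  [/\ riemann_solution P beta rl ul rr ur rho u,
      Num.max rl rr < rs,
      vs - ul = velocity_jump P rl rs /\ ur - vs = velocity_jump P rs rr,
      path_from_0 x1 (fun t => shock_speed rl ul rs vs + beta * t) /\
      path_from_0 x2 (fun t => shock_speed rs vs rr ur + beta * t) &
      forall x t, 0 < t ->
        [/\ x < x1 t -> rho x t = rl /\ u x t = ul + beta * t,
            x1 t < x < x2 t -> rho x t = rs /\ u x t = vs + beta * t &
            x2 t < x -> rho x t = rr /\ u x t = ur + beta * t]].

(** * Delta shocks of the transportation equations *)

(* The value on the curve X is immaterial, the singular part being carried
   separately by the weight w. *)
Definition step (R : realType) (X : R -> R) (l r : R -> R) (x t : R) : R :=
  if x < X t then l t else r t.

(* <rho u^k, psi> *)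
Definition delta_pairing (R : realType) (beta rl ul rr ur : R)
    (X w ud : R -> R) (k : nat) (psi : R * R -> R) : R :=
  pairing (step X (fun t => rl * (ul + beta * t) ^+ k)
                  (fun t => rr * (ur + beta * t) ^+ k)) psi
  + \int[lebesgue_measure]_(t in `]0, +oo[)
      (w t * ud t ^+ k * psi (X t, t)).

Definition delta_shock_solution (R : realType) (beta rl ul rr ur : R)
    (X w ud : R -> R) : Prop :=
  let pair := delta_pairing beta rl ul rr ur X w ud in
  [/\ path_from_0 X ud, w 0 = 0,
      forall t, 0 < t -> ur + beta * t < ud t < ul + beta * t &
      forall psi, test_function psi ->
        pair 0%N (dt psi) + pair 1%N (dx psi) = 0 /\
        pair 1%N (dt psi) + pair 2%N (dx psi) = - (beta * pair 0%N psi)].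

Definition sigma0 (R : realType) (rl ul rr ur : R) : R :=
  (Num.sqrt rl * ul + Num.sqrt rr * ur) / (Num.sqrt rl + Num.sqrt rr).

Definition delta_velocity (R : realType) (beta rl ul rr ur t : R) : R :=
  sigma0 rl ul rr ur + beta * t.

Definition delta_position (R : realType) (beta rl ul rr ur t : R) : R :=
  sigma0 rl ul rr ur * t + 2^-1 * beta * t ^+ 2.

Definition delta_weight (R : realType) (rl ul rr ur t : R) : R :=
  Num.sqrt (rl * rr) * (ul - ur) * t.

(** * Convergence as A, B -> 0+ *)

(* A and B tend to 0 from the right, independently of each other. *)
Definition vanishing (R : realType) : set_system (R * R) :=
  filter_prod (0 : R)^'+ (0 : R)^'+.
Arguments vanishing R : clear implicits.

(* The velocity converges off X pointwise, and on X in the sense that the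
   intermediate zone shrinks to X while its velocity tends to ud. Pointwise
   convergence of u at x = X t itself may fail, as X t need not lie between
   the two shocks. *)
Definition converges_to_delta_shock (R : realType) (beta rl ul rr ur : R)
    (vs : R -> R -> R) (x1 x2 : R -> R -> R -> R)
    (rho u : R -> R -> R -> R -> R) (X w ud : R -> R) : Prop :=
  [/\ forall (k : nat) psi, (k <= 2)%N -> test_function psi ->
        pairing (fun x t => rho AB.1 AB.2 x t * u AB.1 AB.2 x t ^+ k) psi
          @[AB --> vanishing R]
        --> delta_pairing beta rl ul rr ur X w ud k psi,
      forall x t, 0 < t -> x != X t ->
        u AB.1 AB.2 x t @[AB --> vanishing R]
        --> step X (fun t => ul + beta * t) (fun t => ur + beta * t) x t,
      forall t, 0 < t -> x1 AB.1 AB.2 t @[AB --> vanishing R] --> X t,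
      forall t, 0 < t -> x2 AB.1 AB.2 t @[AB --> vanishing R] --> X t &
      forall t, 0 < t ->
        (vs AB.1 AB.2 + beta * t) @[AB --> vanishing R] --> ud t].

(* Main.v *)
Require Import Defs.
From mathcomp Require Import all_boot all_order all_algebra.
From mathcomp Require Import all_classical all_reals all_analysis.
From mathcomp Require Import measurable_realfun ring lra.

Set Implicit Arguments.
Unset Strict Implicit.
Unset Printing Implicit Defensive.

Import Order.TTheory GRing.Theory Num.Theory.
Import numFieldNormedType.Exports.

Local Open Scope classical_set_scope.
Local Open Scope ring_scope.

(** As [A, B -> 0] the intermediate density tends to infinity, since otherwise
    both velocity jumps would vanish while their sum is [ul - ur > 0]. Squaring
    the two jump relations then shows that
    [sqrt rl * (ul - vs) - sqrt rr * (vs - ur)] tends to 0, which gives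
    [vs -> sigma0]. Both shock speeds tend to [sigma0], their difference times
    [rs] tends to [sqrt (rl * rr) * (ul - ur)], and their difference times the
    intermediate pressure tends to 0.

    For a test function [psi], pairing it with a function that takes one value
    on each side of two curves and a third value in between reduces to a time
    integral of the primitive of [psi] in [x] along the curves. This integrand
    converges uniformly on the compact time interval carrying [psi], and the
    shrinking intermediate zone leaves a Dirac mass on the limit curve. So the
    moments and the momentum flux of the two-shock solutions converge to the
    pairings of the delta shock, which therefore inherits the weak formulation
    of the two-shock solutions: no direct computation is needed. *)

(** * Limits and integrals *)

Lemma cvg_uncurried (T : Type) (U V W : topologicalType) (G : set_system T)
    (FG : Filter G) (f : U * V -> W) (y : T -> U) (z : T -> V) (y0 : U)
    (z0 : V) :
  {for (y0, z0), continuous f} -> y @ G --> y0 -> z @ G --> z0 ->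
  f (y i, z i) @[i --> G] --> f (y0, z0).
Proof.
move=> cf yG zG.
apply: (@continuous2_cvg _ _ _ _ G FG y z (fun a b => f (a, b))) => //.
rewrite (_ : (fun q => _) = f)//; apply/funext => -[]//.
Qed.

(** Carries the weak identities of the two-shock solutions over to the limit pairings. *)
Lemma near_eq_lim (R : realType) (T : Type) (F : set_system T)
    (FF : ProperFilter F) (f g : T -> R) (a b : R) :
  f @ F --> a -> g @ F --> b -> (\forall i \near F, f i = g i) -> a = b.
Proof.
move=> fa gb fg; apply: (@norm_cvg_unique _ R _ _ a b fa).
by apply: cvg_trans gb; apply: near_eq_cvg; apply: filterS fg.
Qed.

(** Joint convergence along [filter_prod F (nbhs t)] is uniform near [t], and compactness makes it
    uniform on the segment. No dominating function or sequence is involved, so any filter [F] is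
    allowed. *)
Lemma cvg_Rintegral_segment (R : realType) (I : Type) (F : set_system I)
    (FF : Filter F) (h : I -> R -> R) (h0 : R -> R) (a b : R) :
  continuous h0 -> (\forall i \near F, continuous (h i)) ->
  (forall t, h p.1 p.2 @[p --> filter_prod F (nbhs t)] --> h0 t) ->
  \int[lebesgue_measure]_(t in `[a, b]) h i t @[i --> F] -->
  \int[lebesgue_measure]_(t in `[a, b]) h0 t.
Proof.
move=> ch0 ch hh0.
have int_cont (f : R -> R) : continuous f ->
    lebesgue_measure.-integrable `[a, b] (EFin \o f).
  move=> cf; apply: continuous_compact_integrable; first exact: segment_compact.
  exact: continuous_subspaceT.
set m := fine (lebesgue_measure `[a, b]).
have m0 : 0 <= m by rewrite fine_ge0.
apply/cvgrPdist_le => e e0.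
(* The [+ 1] keeps the denominator positive when the segment has measure 0. *)
have d0 : 0 < e / (m + 1) by rewrite divr_gt0// ltr_wpDl.
have close : \forall i \near F,
    `[a, b] `<=` (fun t => `|h i t - h0 t| <= e / (m + 1)).
  have /compact_near_coveringP := @segment_compact R a b.
  apply=> // t _.
  have hd : (fun p => h p.1 p.2 - h0 p.2) @ filter_prod F (nbhs t) --> (0 : R).
    rewrite -(subrr (h0 t)); apply: cvgB; first exact: hh0.
    by apply: (cvg_comp _ _ cvg_snd); exact: ch0.
  have /cvgr0Pnorm_le/(_ _ d0)[[U V] /= [FU tV] UV] := hd.
  by exists (V, U) => // -[t' i] /= [Vt' Ui]; exact: (UV (i, t')).
near=> i.
have chi : continuous (h i) by near: i.
rewrite distrC -RintegralB//; [|exact: int_cont..].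
apply: le_trans (le_normr_Rintegral _ _) _ => //.
  by apply: int_cont => t; apply: cvgB; [exact: chi|exact: ch0].
apply: (@le_trans _ _ (\int[lebesgue_measure]_(t in `[a, b]) (e / (m + 1)))).
  apply: le_Rintegral => //.
  - apply: int_cont => t; apply: cvg_norm.
    by apply: cvgB; [exact: chi|exact: ch0].
  - by apply: int_cont => t; exact: cvg_cst.
  - by move=> t abt; apply: (near close i).
rewrite Rintegral_cst// -/m mulrAC ler_pdivrMr ?ltr_wpDl//.
by rewrite ler_pM2l// lerDl.
Unshelve. all: by end_near. Qed.

Section compactly_supported.
Context (R : realType) (f : R -> R) (a b : R).
Hypotheses (cf : continuous f) (f0 : forall x, x \notin `[a, b] -> f x = 0).
Notation mu := (@lebesgue_measure R).

Lemma integrable_compact_support (D : set (measurableTypeR R)) : measurable D ->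
  mu.-integrable D (EFin \o f).
Proof.
move=> mD; apply: (@integrableS _ _ _ _ setT) => //.
have -> : EFin \o f = (EFin \o f) \_ `[a, b].
  apply/funext => x; rewrite patchE; case: ifPn => //= xab.
  by rewrite f0//; apply: contra xab => xab; rewrite inE.
apply/integrable_restrict => //; rewrite setTI.
apply: continuous_compact_integrable; first exact: segment_compact.
exact: continuous_subspaceT.
Qed.

Lemma Rintegral_compact_support (D E : set R) :
  (forall x, x \in `[a, b] -> D x <-> E x) ->
  \int[mu]_(x in D) f x = \int[mu]_(x in E) f x.
Proof.
move=> DE; rewrite Rintegral_mkcond [RHS]Rintegral_mkcond; congr Rintegral.
apply/funext => x; rewrite !patchE.
case: (boolP (x \in `[a, b])) => [/DE xDE|/f0 ->]; last by rewrite !if_same.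
by rewrite (_ : (x \in D) = (x \in E))//; apply/idP/idP; rewrite !inE => /xDE.
Qed.

End compactly_supported.

Lemma integrable_setU (d : measure_display) (T : measurableType d)
    (R : realType) (mu : {measure set T -> \bar R}) (f : T -> \bar R)
    (A B : set T) :
  measurable A -> measurable B -> [disjoint A & B] ->
  mu.-integrable A f -> mu.-integrable B f -> mu.-integrable (A `|` B) f.
Proof.
move=> mA mB AB /integrableP[mfA fA] /integrableP[mfB fB].
have mf : measurable_fun (A `|` B) f by exact/measurable_funU.
apply/integrableP; split => //; rewrite ge0_integral_setU//.
  exact: lte_add_pinfty.
exact: measurableT_comp.
Qed.

Section cut.
Context (R : realType).
Notation mu := (@lebesgue_measure R).

(** Every function is measurable on a singleton, so values left unspecified at a jump do no harm. *)
Lemma integrable_set1 (f : R -> R) (y : R) :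
  mu.-integrable [set y] (EFin \o f).
Proof.
apply/integrableP; split; first exact: measurable_fun_set1.
by rewrite integral_set1.
Qed.

(** Nothing is known of [f] at [y], as for a gas state on a shock curve. Integrability on the whole
    interval is rebuilt from the two sides and the null point, and is returned so that cuts can be
    iterated. *)
Lemma Rintegral_cut (f : R -> R) (a b : itv_bound R) (y : R) :
  (a <= BLeft y)%O -> (BRight y <= b)%O ->
  mu.-integrable [set` Interval a (BLeft y)] (EFin \o f) ->
  mu.-integrable [set` Interval (BRight y) b] (EFin \o f) ->
  mu.-integrable [set` Interval a b] (EFin \o f) /\
  \int[mu]_(x in [set` Interval a b]) f x =
    \int[mu]_(x in [set` Interval a (BLeft y)]) f x +
    \int[mu]_(x in [set` Interval (BRight y) b]) f x.
Proof.
move=> ay yb ifa ifb.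
have yy : (BLeft y <= BRight y :> itv_bound R)%O by rewrite bnd_simp.
rewrite (@itv_bndbnd_setU _ _ _ (BLeft y))//; last exact: le_trans yb.
rewrite (@itv_bndbnd_setU _ _ (BLeft y) (BRight y))//.
have dy : [disjoint [set` Interval (BLeft y) (BRight y)]
    & [set` Interval (BRight y) b]].
  apply/disj_setPS => x [] /=; rewrite !itv_boundlr !bnd_simp.
  by move=> /andP[_ xy] /andP[]; rewrite ltNge xy.
have dab : [disjoint [set` Interval a (BLeft y)]
    & [set` Interval (BLeft y) (BRight y)] `|` [set` Interval (BRight y) b]].
  apply/disj_setPS => x [] /=; rewrite !itv_boundlr !bnd_simp.
  move=> /andP[_ xy] [] /andP[]; first by rewrite leNgt xy.
  by rewrite ltNge (ltW xy).
have i1 : mu.-integrable [set` Interval (BLeft y) (BRight y)] (EFin \o f).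
  by rewrite set_itv1; exact: integrable_set1.
have iyb : mu.-integrable
    ([set` Interval (BLeft y) (BRight y)] `|` [set` Interval (BRight y) b])
    (EFin \o f) by exact: integrable_setU.
have iab : mu.-integrable ([set` Interval a (BLeft y)] `|`
    ([set` Interval (BLeft y) (BRight y)] `|` [set` Interval (BRight y) b]))
    (EFin \o f) by apply: integrable_setU => //; exact: measurableU.
split=> //; rewrite Rintegral_setU//; last exact: measurableU.
by rewrite Rintegral_setU// set_itv1 Rintegral_set1 add0r.
Qed.

End cut.

(** * Primitives in the space variable *)

Section primitive.
Context (R : realType) (psi : R * R -> R) (b : R).
Hypotheses (cpsi : continuous psi)
  (psi0 : forall x t, psi (x, t) != 0 -> -b <= x <= b /\ 0 < t <= b).
Notation mu := (@lebesgue_measure R).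

Definition primitive (y t : R) : R := \int[mu]_(x in `]-oo, y]) psi (x, t).

Let cpsi1 (t : R) : continuous (fun x : R => psi (x, t)).
Proof.
move=> x; apply: (@cvg_uncurried _ _ _ _ _ _ psi id (cst t)).
- exact: cpsi.
- exact: cvg_id.
- exact: cvg_cst.
Qed.

Let psi01 (t x : R) : x \notin `[-b, b] -> psi (x, t) = 0.
Proof.
by move=> xb; apply: contraNeq xb => /psi0[xb _]; rewrite in_itv.
Qed.

Let ipsi (t : R) (D : set (measurableTypeR R)) : measurable D ->
  mu.-integrable D (EFin \o (fun x => psi (x, t))).
Proof. exact: (integrable_compact_support (@cpsi1 t) (@psi01 t)). Qed.

Lemma is_derive_primitive (y t : R) :
  is_derive y 1 (primitive ^~ t) (psi (y, t)).
Proof.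
have [||||d <-] := @continuous_FTC1 R (fun x => psi (x, t)) -oo%O y (y + 1).
- by rewrite ltrDl.
- exact: ipsi.
- by rewrite ltNyr.
- exact: cpsi1.
by rewrite derive1E; exact: derivableP.
Qed.

(** The distance bound on [c] holds for either order of [y1] and [y2]. The lemma yields both a
    Lipschitz estimate in [y] and the concentration of mass at a point. *)
Lemma primitive_MVT (y1 y2 t : R) : exists c,
  `|c - y1| <= `|y2 - y1| /\
  primitive y2 t - primitive y1 t = psi (c, t) * (y2 - y1).
Proof.
have cP : continuous (primitive ^~ t).
  move=> y; have [dP _] := is_derive_primitive y t.
  exact/differentiable_continuous/derivable1_diffP.
have main z1 z2 : z1 <= z2 -> exists2 c, c \in `[z1, z2] &
    primitive z2 t - primitive z1 t = psi (c, t) * (z2 - z1).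
  move=> z12.
  apply: (@MVT_segment _ (primitive ^~ t) (fun y => psi (y, t))) => //.
  - by move=> x _; exact: is_derive_primitive.
  - exact: continuous_subspaceT.
have [/main|/ltW/main] := leP y1 y2 => -[c]; rewrite in_itv/= => /andP[c1 c2] e.
  exists c; split=> //; rewrite !ger0_norm ?subr_ge0//; last exact: le_trans c2.
  by rewrite lerD2r.
exists c; split; last by rewrite -[LHS]opprB e -mulrN opprB.
rewrite !ler0_norm ?subr_le0//; last exact: le_trans c2.
by rewrite lerN2 lerD2r.
Qed.

Lemma primitive_total (t : R) : \int[mu]_x psi (x, t) = primitive b t.
Proof.
apply: (Rintegral_compact_support (@psi01 t)) => x.
by rewrite in_itv/= => /andP[_ xb]; split => //= _; rewrite in_itv.
Qed.

Lemma primitive_eq0 (y t : R) : ~~ (0 < t <= b) -> primitive y t = 0.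
Proof.
move=> tb; rewrite /primitive (@eq_Rintegral _ _ _ _ _ (cst 0)); last first.
  by move=> x _; apply: contraNeq tb => /psi0[].
by rewrite Rintegral_cst// mul0r.
Qed.

Lemma compact_support_bounded : exists2 K, 0 < K & forall p, `|psi p| <= K.
Proof.
have cptb : compact (`[-b, b] `*` `[0, b] : set (R * R)).
  by apply: compact_setX; exact: segment_compact.
have /compact_bounded[M [_ MK]] : compact (psi @` (`[-b, b] `*` `[0, b])).
  by apply: continuous_compact => //; exact: continuous_subspaceT.
(* Compactness gives a bound by every number strictly above [M]; this one is also positive. *)
exists (`|M| + 1) => [|[x t]]; first by rewrite ltr_wpDl.
have [->|/psi0[xb /andP[t0 tb]]] := eqVneq (psi (x, t)) 0.
  by rewrite normr0 addr_ge0.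
apply: MK; first by rewrite (le_lt_trans (ler_norm _))// ltrDl.
by exists (x, t) => //; split; rewrite /= in_itv//= tb ltW.
Qed.

(** Continuity in [t] at fixed [y] combines with a Lipschitz estimate in [y] whose constant [K] is
    uniform in [t]. *)
Lemma continuous_primitive : continuous (fun p => primitive p.1 p.2).
Proof.
have [K K0 psiK] := compact_support_bounded.
have ct y : continuous (primitive y).
  (* Since [psi] vanishes left of [-b], the half-line can be cut down to a segment, where
     convergence of integrals is available. *)
  have -> : primitive y = fun t => \int[mu]_(x in `[-b, y]) psi (x, t).
    apply/funext => t; apply: (Rintegral_compact_support (@psi01 t)) => x.
    by rewrite in_itv/= => /andP[bx _]; rewrite /= !in_itv/= bx.
  move=> t; apply: (@cvg_Rintegral_segment _ _ _ _ (fun t x => psi (x, t))).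
  - exact: cpsi1.
  - by apply: nearW => s; exact: cpsi1.
  - move=> x; apply: (@cvg_uncurried _ _ _ _ _ _ psi snd fst).
    + exact: cpsi.
    + exact: cvg_snd.
    + exact: cvg_fst.
move=> [y t] /=; apply/cvgrPdist_lt => e e0.
have e2 : 0 < e / 2 by rewrite divr_gt0.
near=> p.
have [c [_ ec]] := primitive_MVT y p.1 p.2.
have -> : primitive y t - primitive p.1 p.2 =
   (primitive y t - primitive y p.2) - (psi (c, p.2) * (p.1 - y)).
  by rewrite -ec; ring.
rewrite [e]splitr (le_lt_trans (ler_normB _ _))// ltrD//.
  near: p; apply: (@cvgr_dist_lt _ _ _ (nbhs (y, t)) _
    (fun p => primitive y p.2)) => //.
  by apply: (@cvg_comp _ _ _ snd (primitive y)); [exact: cvg_snd|exact: ct].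
rewrite normrM (@le_lt_trans _ _ (K * `|p.1 - y|))//.
  by rewrite ler_wpM2r.
rewrite -ltr_pdivlMl// distrC; near: p.
apply: (@cvgr_dist_lt _ _ _ (nbhs (y, t)) _ fst) => //; first exact: cvg_fst.
by rewrite mulr_gt0// invr_gt0.
Unshelve. all: by end_near. Qed.

Lemma cvg_primitive (T : Type) (G : set_system T) (FG : Filter G)
    (y t : T -> R) (y0 t0 : R) :
  y @ G --> y0 -> t @ G --> t0 ->
  primitive (y z) (t z) @[z --> G] --> primitive y0 t0.
Proof.
apply: (@cvg_uncurried _ _ _ _ _ _ (fun p => primitive p.1 p.2)).
exact: continuous_primitive.
Qed.

(* The mass [m z * (y2 z - y1 z)] carried by a shrinking interval concentrates
   at the limit point. *)
Lemma cvg_primitive_concentration (T : Type) (G : set_system T)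
    (FG : Filter G) (m y1 y2 t : T -> R) (y0 t0 m0 : R) :
  y1 @ G --> y0 -> y2 @ G --> y0 -> t @ G --> t0 ->
  m z * (y2 z - y1 z) @[z --> G] --> m0 ->
  m z * (primitive (y2 z) (t z) - primitive (y1 z) (t z)) @[z --> G] -->
    m0 * psi (y0, t0).
Proof.
move=> y1G y2G tG mG.
(* The increment of the primitive is the width times [psi] at a point [c z], which is squeezed to
   [y0] together with both endpoints. *)
have /choice[c cP] z := primitive_MVT (y1 z) (y2 z) (t z).
have cG : c @ G --> y0.
  have -> : c = fun z => y1 z + (c z - y1 z).
    by apply/funext => z; rewrite addrC subrK.
  rewrite -[y0]addr0; apply: cvgD => //; apply/norm_cvg0P.
  apply: (@squeeze_cvgr _ _ _ _ (cst 0) (fun z => `|y2 z - y1 z|)).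
  - by apply: nearW => z; rewrite normr_ge0 (cP z).1.
  - exact: cvg_cst.
  - by rewrite -(normr0 R) -(subrr y0); apply: cvg_norm; exact: cvgB.
have -> : (fun z => m z * (primitive (y2 z) (t z) - primitive (y1 z) (t z))) =
    fun z => m z * (y2 z - y1 z) * psi (c z, t z).
  by apply/funext => z; rewrite (cP z).2; ring.
by apply: cvgM => //; apply: cvg_uncurried => //; exact: cpsi.
Qed.

Lemma Rintegral_three_states (g : R -> R) (l m r y1 y2 t : R) : y1 <= y2 ->
  (forall x, x < y1 -> g x = l) -> (forall x, y1 < x < y2 -> g x = m) ->
  (forall x, y2 < x -> g x = r) ->
  \int[mu]_x (g x * psi (x, t)) =
    l * primitive y1 t + m * (primitive y2 t - primitive y1 t)
    + r * (primitive b t - primitive y2 t).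
Proof.
move=> y12 gl gm gr.
have piece (k : R) (D : set (measurableTypeR R)) :
    measurable D -> (forall x, D x -> g x = k) ->
    mu.-integrable D (EFin \o (fun x => g x * psi (x, t))) /\
    \int[mu]_(x in D) (g x * psi (x, t)) = k * \int[mu]_(x in D) psi (x, t).
  move=> mD gD; have gk : {in D, (fun x => g x * psi (x, t)) =1
      (fun x => k * psi (x, t))} by move=> x /set_mem/gD ->.
  split; last first.
    by rewrite -RintegralZl//; [exact: eq_Rintegral|exact: ipsi].
  apply: eq_integrable (integrableZl mD k (@ipsi t D mD)) => //.
  by move=> x /gk /= ->.
have [x|il el] := piece l `]-oo, y1[%classic (measurable_itv _).
  by rewrite /= in_itv/=; exact: gl.
have [x|ir er] := piece r `]y2, +oo[%classic (measurable_itv _).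
  by rewrite /= in_itv/= andbT; exact: gr.
have [x|im em] := piece m `]y1, y2[%classic (measurable_itv _).
  by rewrite /= in_itv/=; exact: gm.
have el' : \int[mu]_(x in `]-oo, y1[) psi (x, t) = primitive y1 t.
  by rewrite Rintegral_itv_bndo_bndc//; exact: ipsi.
have er' : \int[mu]_(x in `]y2, +oo[) psi (x, t) =
    primitive b t - primitive y2 t.
  rewrite -primitive_total -set_itvNyy -(@Rintegral_itvB _ _ -oo%O _ y2)//.
  exact: ipsi.
rewrite er' in er; rewrite el' in el; rewrite -set_itvNyy.
(* Two cuts require [y1 < y2]; when the jumps coincide the middle zone is empty and a single cut
   suffices. *)
have [y12'|] := ltP y1 y2; last first.
  move=> y21; have e : y1 = y2 by apply/eqP; rewrite eq_le y12.
  have [//|//||//|_ ->] :=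
    @Rintegral_cut _ (fun x => g x * psi (x, t)) -oo%O +oo%O y2.
    by rewrite -e.
  by rewrite -[in LHS]e el e er; ring.
have em' : \int[mu]_(x in `]y1, y2[) psi (x, t) =
    primitive y2 t - primitive y1 t.
  rewrite Rintegral_itv_bndo_bndc; last exact: ipsi.
  by rewrite -(@Rintegral_itvB _ _ -oo%O _ y1)// ?bnd_simp//; exact: ipsi.
have [|||//|iml eml] := @Rintegral_cut _ (fun x => g x * psi (x, t))
    -oo%O (BLeft y2) y1.
- by [].
- by [].
- by [].
have [||||_ ->] := @Rintegral_cut _ (fun x => g x * psi (x, t)) -oo%O +oo%O y2.
- by [].
- by [].
- by [].
- by [].
by rewrite eml el em em' er.
Qed.



(** * Pairings with functions having three states *)

(** Only positive times constrain [g], but the curves and values are continuous everywhere, so that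
    [slice] is continuous on the closed segment [[0, b]]. *)
Definition three_states (y1 y2 l m r : R -> R) (g : R -> R -> R) : Prop :=
  [/\ continuous y1, continuous y2, continuous l, continuous m & continuous r]
  /\ forall x t, 0 < t -> [/\ y1 t <= y2 t, x < y1 t -> g x t = l t,
       y1 t < x < y2 t -> g x t = m t & y2 t < x -> g x t = r t].

(** The inner integral of the pairing at time [t], as evaluated by [Rintegral_three_states]. *)
Definition slice (y1 y2 l m r : R -> R) (t : R) : R :=
  l t * primitive (y1 t) t + m t * (primitive (y2 t) t - primitive (y1 t) t)
  + r t * (primitive b t - primitive (y2 t) t).

Lemma continuous_slice y1 y2 l m r g :
  three_states y1 y2 l m r g -> continuous (slice y1 y2 l m r).
Proof.
move=> [[cy1 cy2 cl cm cr] _] t.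
have cP1 : primitive (y1 s) s @[s --> t] --> primitive (y1 t) t.
  by apply: cvg_primitive; [exact: cy1|exact: cvg_id].
have cP2 : primitive (y2 s) s @[s --> t] --> primitive (y2 t) t.
  by apply: cvg_primitive; [exact: cy2|exact: cvg_id].
have cPb : primitive b s @[s --> t] --> primitive b t.
  by apply: cvg_primitive; [exact: cvg_cst|exact: cvg_id].
apply: cvgD; first apply: cvgD.
- by apply: cvgM => //; exact: cl.
- by apply: cvgM; [exact: cm|exact: cvgB].
- by apply: cvgM; [exact: cr|exact: cvgB].
Qed.

Lemma Rintegral_time_support (f : R -> R) :
  (forall t, ~~ (0 < t <= b) -> f t = 0) ->
  \int[mu]_(t in `]0, +oo[) f t = \int[mu]_(t in `[0, b]) f t.
Proof.
move=> f0; rewrite Rintegral_mkcond [RHS]Rintegral_mkcond; congr Rintegral.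
apply/funext => t; rewrite !patchE.
have [tb|/f0 ->] := boolP (0 < t <= b); last by rewrite !if_same.
have /andP[t0 tb'] := tb.
by rewrite !mem_set//= in_itv/= ?t0// tb' ltW.
Qed.

Lemma pairing_three_states y1 y2 l m r g : three_states y1 y2 l m r g ->
  pairing g psi = \int[mu]_(t in `[0, b]) slice y1 y2 l m r t.
Proof.
move=> [_ gE]; rewrite -Rintegral_time_support; last first.
  by move=> t tb; rewrite /slice !primitive_eq0// !subrr !mulr0 !addr0.
apply: eq_Rintegral => t; rewrite inE/= in_itv/= andbT => t0.
apply: (@Rintegral_three_states (g ^~ t)) => [|x|x|x].
- by have [] := gE 0 t t0.
- by have [] := gE x t t0.
- by have [] := gE x t t0.
- by have [] := gE x t t0.
Qed.

(** Pulls [beta] out of the friction term. Linearity rests on integrability in time, supplied by the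
    continuity of [slice]. *)
Lemma pairingZ_three_states y1 y2 l m r g k : three_states y1 y2 l m r g ->
  pairing (fun x t => k * g x t) psi = k * pairing g psi.
Proof.
move=> gs; have [[cy1 cy2 cl cm cr] gE] := gs.
have kgs : three_states y1 y2 (fun t => k * l t) (fun t => k * m t)
    (fun t => k * r t) (fun x t => k * g x t).
  split=> [|x t t0].
    by split => // t; (apply: cvgM; first exact: cvg_cst);
      [exact: cl|exact: cm|exact: cr].
  have [y12 gl gm gr] := gE x t t0.
  by split => // [/gl|/gm|/gr] ->.
rewrite (pairing_three_states kgs) (pairing_three_states gs) -RintegralZl//.
  by apply: eq_Rintegral => t _; rewrite /slice; ring.
apply: continuous_compact_integrable; first exact: segment_compact.
exact/continuous_subspaceT/(continuous_slice gs).
Qed.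

(** The limit profile is the degenerate case of coinciding curves. The middle value is never
    attained, and choosing 0 removes the middle term of [slice]. *)
Lemma three_states_step (X l r : R -> R) :
  continuous X -> continuous l -> continuous r ->
  three_states X X l (cst 0) r (step X l r).
Proof.
move=> cX cl cr; split => [|x t t0].
  by split => // t; exact: cvg_cst.
rewrite /step; split => // [->//|/andP[/lt_trans /[apply]]|Xx].
  by rewrite ltxx.
by rewrite ltNge (ltW Xx).
Qed.

(** The middle value [m] may blow up: only its product with the width of the zone needs a limit,
    which becomes the weight of the Dirac mass. *)
Lemma cvg_pairing (I : Type) (F : set_system I) (FF : Filter F)
    (y1 y2 l m r : I -> R -> R) (g : I -> R -> R -> R) (X l0 r0 m0 : R -> R) :
  (\forall i \near F, three_states (y1 i) (y2 i) (l i) (m i) (r i) (g i)) ->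
  continuous X -> continuous l0 -> continuous r0 -> continuous m0 ->
  (forall t, let G := filter_prod F (nbhs t) in
    [/\ y1 p.1 p.2 @[p --> G] --> X t,
        y2 p.1 p.2 @[p --> G] --> X t,
        l p.1 p.2 @[p --> G] --> l0 t,
        m p.1 p.2 * (y2 p.1 p.2 - y1 p.1 p.2) @[p --> G] --> m0 t &
        r p.1 p.2 @[p --> G] --> r0 t]) ->
  pairing (g i) psi @[i --> F] -->
    pairing (step X l0 r0) psi
    + \int[mu]_(t in `]0, +oo[) (m0 t * psi (X t, t)).
Proof.
move=> gs cX cl0 cr0 cm0 cvg.
have ts0 := three_states_step cX cl0 cr0.
have cs0 := continuous_slice ts0.
have cpX : continuous (fun t => m0 t * psi (X t, t)).
  move=> t; apply: cvgM; first exact: cm0.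
  by apply: cvg_uncurried; [exact: cpsi|exact: cX|exact: cvg_id].
have int_cont (f : R -> R) : continuous f ->
    mu.-integrable `[0, b] (EFin \o f).
  move=> cf; apply: continuous_compact_integrable; first exact: segment_compact.
  exact: continuous_subspaceT.
rewrite (pairing_three_states ts0) Rintegral_time_support; last first.
  move=> t tb; rewrite (_ : psi _ = 0) ?mulr0//.
  by apply: contraNeq tb => /psi0[].
rewrite -RintegralD//; [|exact: int_cont..].
apply: (@cvg_trans _ ((\int[mu]_(t in `[0, b])
    slice (y1 i) (y2 i) (l i) (m i) (r i) t) @[i --> F])).
  apply: near_eq_cvg; near=> i; apply/esym/pairing_three_states.
  by near: i.
apply: cvg_Rintegral_segment => [t||t].
- by apply: cvgD; [exact: cs0|exact: cpX].
- by apply: filterS gs => i; exact: continuous_slice.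
have [/= y1G y2G lG mG rG] := cvg t.
have tG : snd p @[p --> filter_prod F (nbhs t)] --> t by exact: cvg_snd.
have P1 := cvg_primitive _ y1G tG; have P2 := cvg_primitive _ y2G tG.
have Pb := cvg_primitive _ (cvg_cst b) tG.
(* The Dirac term moves to the middle, so that the limits of the left, intermediate and right
   contributions match one by one. *)
rewrite /slice mul0r addr0 addrAC; apply: cvgD; first apply: cvgD.
- by apply: cvgM; [exact: lG|exact: P1].
- exact: (cvg_primitive_concentration _ y1G y2G tG mG).
- by apply: cvgM; [exact: rG|apply: cvgB; [exact: Pb|exact: P2]].
Unshelve. all: by end_near. Qed.

End primitive.

(** * Test functions and shock curves *)

Lemma test_function_support (R : realType) (psi : R * R -> R) :
  test_function psi ->
  exists b, forall x t, psi (x, t) != 0 -> -b <= x <= b /\ 0 < t <= b.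
Proof.
move=> [_ cpt pos]; have [M [_ MS]] := compact_bounded cpt.
exists (`|M| + 1) => x t xt0.
have St : supp psi (x, t) by exact: subset_closure.
have : `|(x, t)| <= `|M| + 1.
  by apply: MS => //; rewrite (le_lt_trans (ler_norm _))// ltrDl.
rewrite prod_normE/= ge_max => /andP[xM tM].
by rewrite -ler_norml xM (pos _ St)/= (le_trans (ler_norm _)).
Qed.

Lemma test_function_continuous (R : realType) (psi : R * R -> R) :
  test_function psi -> continuous psi.
Proof. by move=> [/(_ 0%N)]. Qed.

(** Off its support [psi] is locally zero, hence so are its derivatives, and the support does not
    grow. *)
Lemma test_function_derive (R : realType) (psi : R * R -> R) (v : R * R) :
  test_function psi -> test_function ('D_v psi).
Proof.
move=> [Cpsi cpt pos].
have sub : supp ('D_v psi) `<=` supp psi.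
  rewrite [supp psi](closure_id _).1; last exact: closed_closure.
  apply: closure_subset => p; apply: contraPP => Np.
  have e0 : \near p, psi p = (cst 0 : R * R -> R) p.
    have : nbhs p (~` supp psi).
      by apply: open_nbhs_nbhs; split=> //; exact/closed_openC/closed_closure.
    apply: filterS => q Nq; apply/eqP; apply: contra_notT Nq => q0.
    exact: subset_closure.
  by rewrite /= (near_eq_derive _ e0) derive_cst eqxx.
split=> [k||]; last exact: subset_trans pos.
- by have [_] := Cpsi k.+1; exact.
- exact: (subclosed_compact (@closed_closure _ _) cpt sub).
Qed.

Lemma is_derive_parabola (R : realType) (s beta z : R) :
  is_derive z 1 (fun t => s * t + 2^-1 * beta * t ^+ 2) (s + beta * z).
Proof.
have -> : (fun t => s * t + 2^-1 * beta * t ^+ 2) =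
    s *: id + (2^-1 * beta) *: (id * id).
  by apply/funext => y; rewrite expr2.
have di := is_derive_id z (1 : R).
apply: (is_derive_eq (is_deriveD (is_deriveZ s di)
  (is_deriveZ (2^-1 * beta) (is_deriveM di di)))).
by rewrite /GRing.scale/=; field.
Qed.

(** The difference with the parabola is continuous on [[0, t]], vanishes at 0 and has zero
    derivative inside, so the mean value theorem applies. *)
Lemma path_from_0_affine (R : realType) (x : R -> R) (s beta : R) :
  path_from_0 x (fun t => s + beta * t) ->
  forall t, 0 < t -> x t = s * t + 2^-1 * beta * t ^+ 2.
Proof.
move=> [x0 cx dx] t t0.
pose q (t : R) := s * t + 2^-1 * beta * t ^+ 2.
have dq (z : R) : is_derive z 1 q (s + beta * z) by exact: is_derive_parabola.
have cq : continuous q.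
  move=> z; have [dz _] := dq z.
  exact/differentiable_continuous/derivable1_diffP.
have [||c _] := @MVT _ (fun t => x t - q t) (fun=> 0) 0 t t0.
- move=> z; rewrite in_itv/= => /andP[z0 _].
  by apply: (is_derive_eq (is_deriveB (dx _ z0) (dq z))); rewrite subrr.
- have cx' : {within `[0, t], continuous x}.
    apply: continuous_subspaceW cx => w /=; rewrite !in_itv/= andbT.
    by move=> /andP[].
  by move=> z; apply: cvgB; [exact: cx'|exact: continuous_subspaceT].
rewrite x0 mul0r /q mulr0 expr0n/= mulr0 addr0 !subr0 => /eqP.
by rewrite subr_eq0 => /eqP.
Qed.

(** * The vanishing pressure limit of the intermediate state *)

Section asymptotics.
Context (R : realType) (n alpha rl ul rr ur : R) (rs vs : R * R -> R).
Hypotheses (hn : 0 <= n) (ha : 0 <= alpha) (hrl : 0 < rl) (hrr : 0 < rr)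
  (hu : ur < ul).
Notation V := (vanishing R).
Notation P := (fun AB : R * R => pressure AB.1 AB.2 n alpha).
Notation s0 := (sigma0 rl ul rr ur).
Lemma vanishing_gt0 : \forall AB \near V, 0 < AB.1 /\ 0 < AB.2.
Proof.
by exists ([set x : R | 0 < x], [set x : R | 0 < x]);
  [split; exact: nbhs_right_gt|move=> [A B]].
Qed.

Lemma cvg_vanishing1 : AB.1 @[AB --> V] --> (0 : R).
Proof. by apply: cvg_trans (cvg_fst) _; exact: cvg_within. Qed.

Lemma cvg_vanishing2 : AB.2 @[AB --> V] --> (0 : R).
Proof. by apply: cvg_trans (cvg_snd) _; exact: cvg_within. Qed.

Lemma cvg_pressure (r : R) : P AB r @[AB --> V] --> 0.
Proof.
have -> : 0 = 0 * r `^ n - 0 / r `^ alpha by rewrite !mul0r subr0.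
by apply: cvgB; (apply: cvgM; last exact: cvg_cst);
  [exact: cvg_vanishing1|exact: cvg_vanishing2].
Qed.

Lemma le_pressure (A B : R) : 0 < A -> 0 < B ->
  {in Num.pos &, {homo pressure A B n alpha : x y / x <= y}}.
Proof.
move=> A0 B0 x y; rewrite !posrE => x0 y0 xy.
apply: lerB; first by rewrite ler_pM2l// ge0_ler_powR// nnegrE ltW.
by rewrite ler_pM2l// lef_pV2 ?posrE ?powR_gt0// ge0_ler_powR// nnegrE ltW.
Qed.

(** The jump between the two fixed densities vanishes with the pressure while [ur < ul], so the
    region IV condition holds automatically near the limit. *)
Lemma near_region_IV : \forall AB \near V, region_IV (P AB) rl ul (rr, ur).
Proof.
have jump0 : velocity_jump (P AB) rl rr @[AB --> V] --> 0.
  have -> : 0 = - Num.sqrt ((rr - rl) / (rr * rl) * (0 - 0)).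
    by rewrite subrr mulr0 sqrtr0 oppr0.
  apply: cvgN; apply: continuous_cvg; first exact: sqrt_continuous.
  by apply: cvgM; [exact: cvg_cst|apply: cvgB; exact: cvg_pressure].
near=> AB; split => //=; rewrite addrC -ltrBlDr; near: AB.
by apply: (cvgr_gt _ jump0); rewrite subr_lt0.
Unshelve. all: by end_near. Qed.

Hypothesis jumps : \forall AB \near V,
  [/\ Num.max rl rr < rs AB, vs AB - ul = velocity_jump (P AB) rl (rs AB) &
      ur - vs AB = velocity_jump (P AB) (rs AB) rr].

(** The factor [(r2 - r1) / (r2 * r1)] is written as a difference of inverse densities, since it is
    [(rs AB)^-1] that tends to 0. The signs make the squares invertible. *)
Definition squared_jumps (AB : R * R) : Prop :=
  [/\ 0 <= ul - vs AB, 0 <= vs AB - ur,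
    (ul - vs AB) ^+ 2 = (rl^-1 - (rs AB)^-1) * (P AB (rs AB) - P AB rl) &
    (vs AB - ur) ^+ 2 = (rr^-1 - (rs AB)^-1) * (P AB (rs AB) - P AB rr)].

(** The radicands are nonnegative because [rs] exceeds both outer densities and the pressure is
    nondecreasing. *)
Lemma velocity_jump_sqr : \forall AB \near V, squared_jumps AB.
Proof.
near=> AB.
have [A0 B0] : 0 < AB.1 /\ 0 < AB.2 by near: AB; exact: vanishing_gt0.
have [+ e1 e2] : [/\ Num.max rl rr < rs AB,
    vs AB - ul = velocity_jump (P AB) rl (rs AB) &
    ur - vs AB = velocity_jump (P AB) (rs AB) rr] by near: AB.
rewrite gt_max => /andP[ls rs'].
have s_gt0 := lt_trans hrl ls.
have rad r : 0 < r -> r < rs AB ->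
    0 <= (r^-1 - (rs AB)^-1) * (P AB (rs AB) - P AB r).
  move=> r0 r_lt; rewrite mulr_ge0// subr_ge0.
    by rewrite lef_pV2 ?posrE ?ltW.
  by apply: le_pressure; rewrite ?posrE ?ltW.
have {}e1 : ul - vs AB =
    Num.sqrt ((rl^-1 - (rs AB)^-1) * (P AB (rs AB) - P AB rl)).
  rewrite -[LHS]opprB e1 /velocity_jump opprK; congr (Num.sqrt (_ * _)).
  by field; rewrite !gt_eqF.
have {}e2 : vs AB - ur =
    Num.sqrt ((rr^-1 - (rs AB)^-1) * (P AB (rs AB) - P AB rr)).
  rewrite -[LHS]opprB e2 /velocity_jump opprK; congr Num.sqrt.
  by field; rewrite !gt_eqF.
by rewrite /squared_jumps e1 e2 !sqr_sqrtr ?rad// !sqrtr_ge0.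
Unshelve. all: by end_near. Qed.

Lemma cvg_intermediate_density : (rs AB)^-1 @[AB --> V] --> 0.
Proof.
apply/cvgrPdist_lt => e e0.
(* This dominates the sum of the two squared jumps as long as [rs AB <= e^-1]: the favourable terms
   are dropped and [rs AB] is replaced by [e^-1]. *)
pose bound (AB : R * R) : R :=
  rl^-1 * (AB.1 * e^-1 `^ n + AB.2 / rl `^ alpha) +
  rr^-1 * (AB.1 * e^-1 `^ n + AB.2 / rr `^ alpha).
have cb : bound AB @[AB --> V] --> 0.
  have term (r : R) :
      r^-1 * (AB.1 * e^-1 `^ n + AB.2 / r `^ alpha) @[AB --> V] --> 0.
    rewrite -(mulr0 r^-1); apply: cvgM; first exact: cvg_cst.
    have -> : 0 = 0 * e^-1 `^ n + 0 / r `^ alpha by rewrite !mul0r addr0.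
    by apply: cvgD; (apply: cvgM; last exact: cvg_cst);
      [exact: cvg_vanishing1|exact: cvg_vanishing2].
  by rewrite -(addr0 0); apply: cvgD; exact: term.
have D0 : 0 < (ul - ur) ^+ 2 / 2 by rewrite divr_gt0// exprn_gt0// subr_gt0.
near=> AB.
have [A0 B0] : 0 < AB.1 /\ 0 < AB.2 by near: AB; exact: vanishing_gt0.
have : Num.max rl rr < rs AB by near: AB; apply: filterS jumps => ? [].
rewrite gt_max => /andP[ls rs'].
have s_gt0 := lt_trans hrl ls.
rewrite sub0r normrN gtr0_norm ?invr_gt0// ltNge; apply/negP => es.
have [_ _ el er] : squared_jumps AB.
  by near: AB; exact: velocity_jump_sqr.
have sK : rs AB <= e^-1.
  by rewrite -[leLHS]invrK lef_pV2 ?posrE ?invr_gt0.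
have le_term r : 0 < r -> r < rs AB ->
    (r^-1 - (rs AB)^-1) * (P AB (rs AB) - P AB r) <=
    r^-1 * (AB.1 * e^-1 `^ n + AB.2 / r `^ alpha).
  move=> r0 r_lt; apply: ler_pM.
  - by rewrite subr_ge0 lef_pV2 ?posrE// ltW.
  - by rewrite subr_ge0; apply: le_pressure; rewrite ?posrE ?ltW.
  - by rewrite lerBlDr lerDl invr_ge0 ltW.
  rewrite /pressure.
  have h1 : AB.1 * rs AB `^ n <= AB.1 * e^-1 `^ n.
    by rewrite ler_pM2l// ge0_ler_powR// nnegrE ltW// invr_gt0.
  have h2 : 0 <= AB.2 / rs AB `^ alpha by rewrite divr_ge0 ?powR_ge0 ?ltW.
  have h3 : 0 <= AB.1 * r `^ n by rewrite mulr_ge0 ?powR_ge0 ?ltW.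
  by lra.
have := le_term _ hrl ls; have := le_term _ hrr rs'.
rewrite -el -er => h1 h2.
have h3 : bound AB < (ul - ur) ^+ 2 / 2.
  by near: AB; apply: (cvgr_lt _ cb).
(* Two numbers of sum [ul - ur] have squares of sum at least [(ul - ur) ^+ 2 / 2], which contradicts
   the smallness of [bound]. *)
have h4 := sqr_ge0 ((ul - vs AB) - (vs AB - ur)).
move: h1 h2 h3; rewrite /bound => h1 h2 h3.
by nra.
Unshelve. all: by end_near. Qed.

Lemma cvg_intermediate_velocity : vs AB @[AB --> V] --> s0.
Proof.
set a := Num.sqrt rl; set b := Num.sqrt rr.
have a0 : 0 < a by rewrite sqrtr_gt0.
have b0 : 0 < b by rewrite sqrtr_gt0.
have aa : a ^+ 2 = rl by rewrite sqr_sqrtr// ltW.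
have bb : b ^+ 2 = rr by rewrite sqr_sqrtr// ltW.
pose D := ul - ur; have D0 : 0 < D by rewrite subr_gt0.
(* [c] is a lower bound for [X + Y] below, so that [X - Y] is controlled by the difference of
   squares; [K] bounds the coefficient of [(rs AB)^-1] in that difference. *)
pose c := Num.min a b * D.
have c0 : 0 < c by rewrite mulr_gt0// lt_min a0.
pose K := 2 * (rl ^+ 2 + rr ^+ 2) * D ^+ 2.
pose bound (AB : R * R) : R := (`|P AB rr - P AB rl| + (rs AB)^-1 * K) / c.
have cb : bound AB @[AB --> V] --> 0.
  rewrite -(mul0r c^-1); apply: cvgM; last exact: cvg_cst.
  rewrite -(addr0 0); apply: cvgD.
    rewrite -(normr0 R) -(subrr 0); apply: cvg_norm.
    by apply: cvgB; exact: cvg_pressure.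
  rewrite -(mul0r K); apply: cvgM; last exact: cvg_cst.
  exact: cvg_intermediate_density.
pose X (AB : R * R) := a * (ul - vs AB); pose Y AB := b * (vs AB - ur).
have XY : X AB - Y AB @[AB --> V] --> 0.
  apply/norm_cvg0P; apply: (@squeeze_cvgr _ _ _ _ (cst 0) bound) => //;
    last exact: cvg_cst.
  (* Once [r / rs < 1/2], the factor [1 - r / rs] exceeds [1/2], and the squared jump controls the
     pressure difference. *)
  have small r : 0 < r -> \forall AB \near V, r * (rs AB)^-1 < 2^-1.
    move=> r0'; have : r * (rs AB)^-1 @[AB --> V] --> 0.
      rewrite -(mulr0 r); apply: cvgM; first exact: cvg_cst.
      exact: cvg_intermediate_density.
    by move/cvgr_lt; apply; rewrite invr_gt0.
  near=> AB; rewrite normr_ge0/=.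
  have [l0 r0 el er] : squared_jumps AB.
    by near: AB; exact: velocity_jump_sqr.
  have sl : rl * (rs AB)^-1 < 2^-1 by near: AB; exact: small.
  have sr : rr * (rs AB)^-1 < 2^-1 by near: AB; exact: small.
  have : Num.max rl rr < rs AB by near: AB; apply: filterS jumps => ? [].
  rewrite gt_max => /andP[ls _].
  have e0 : 0 < (rs AB)^-1 by rewrite invr_gt0 (lt_trans hrl).
  set e := (rs AB)^-1 in el er sl sr e0 *.
  set p := P AB (rs AB) in el er *.
  have {}el : X AB ^+ 2 = (1 - rl * e) * (p - P AB rl).
    by rewrite /X exprMn aa el; field; rewrite gt_eqF.
  have {}er : Y AB ^+ 2 = (1 - rr * e) * (p - P AB rr).
    by rewrite /Y exprMn bb er; field; rewrite gt_eqF.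
  rewrite /bound ler_pdivlMr//.
  have cXY : c <= X AB + Y AB.
    rewrite /c /D (_ : ul - ur = (ul - vs AB) + (vs AB - ur)); last by ring.
    by rewrite mulrDr lerD// ler_wpM2r// ge_min lexx ?orbT.
  have X2 : X AB ^+ 2 <= rl * D ^+ 2.
    by rewrite /X exprMn aa ler_pM2l// ler_sqr ?nnegrE ?(ltW D0)// /D; lra.
  have Y2 : Y AB ^+ 2 <= rr * D ^+ 2.
    by rewrite /Y exprMn bb ler_pM2l// ler_sqr ?nnegrE ?(ltW D0)// /D; lra.
  apply: (@le_trans _ _ `|X AB ^+ 2 - Y AB ^+ 2|).
    rewrite subr_sqr normrM ler_wpM2l// (le_trans cXY)// ler_norm//.
  (* The intermediate pressure [p] cancels at leading order and survives only with the small factor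
     [e]. *)
  have -> : X AB ^+ 2 - Y AB ^+ 2 = (P AB rr - P AB rl) -
      e * (rl * (p - P AB rl) - rr * (p - P AB rr)) by rewrite el er; ring.
  rewrite (le_trans (ler_normB _ _))// lerD2l normrM gtr0_norm// ler_pM2l//.
  have q r (Z q : R) : 0 < r -> r * e < 2^-1 -> Z ^+ 2 = (1 - r * e) * q ->
      Z ^+ 2 <= r * D ^+ 2 -> 0 <= r * q <= 2 * r ^+ 2 * D ^+ 2.
    move=> r0' re Zq ZD.
    have Z0 := sqr_ge0 Z.
    have q0 : 0 <= q by rewrite -(@pmulr_rge0 _ (1 - r * e)) -?Zq//; lra.
    have q2 : q <= 2 * (r * D ^+ 2) by nra.
    apply/andP; split; first by rewrite mulr_ge0// ltW.
    rewrite (_ : 2 * r ^+ 2 * D ^+ 2 = r * (2 * (r * D ^+ 2))); last by ring.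
    by rewrite ler_pM2l.
  have /andP[ql0 ql] := q _ _ _ hrl sl el X2.
  have /andP[qr0 qr] := q _ _ _ hrr sr er Y2.
  by rewrite (le_trans (ler_normB _ _))// !ger0_norm// /K; lra.
have -> : s0 = s0 - 0 / (a + b) by rewrite mul0r subr0.
(* [X - Y] is affine in [vs] with slope [-(a + b)] and root [s0]. *)
have -> : vs = fun AB => s0 - (X AB - Y AB) / (a + b).
  apply/funext => AB; rewrite /sigma0 -/a -/b /X /Y; field.
  by rewrite gt_eqF// addr_gt0.
apply: cvgB; first exact: cvg_cst.
by apply: cvgM => //; exact: cvg_cst.
Unshelve. all: by end_near. Qed.

Let cvg_scaled_density (r : R) : r * (rs AB)^-1 @[AB --> V] --> 0.
Proof.
rewrite -(mulr0 r); apply: cvgM; first exact: cvg_cst.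
exact: cvg_intermediate_density.
Qed.

(** For an outer state [(r, v)] this is [rs] times the excess of the shock speed over [vs]. Its
    finite limit gives both the limit of the speeds and that of their scaled difference. *)
Let cvg_deviation (r v : R) :
  r * (vs AB - v) / (1 - r * (rs AB)^-1) @[AB --> V] --> r * (s0 - v).
Proof.
rewrite -[X in _ --> X]divr1 -[X in _ / X](subr0 1); apply: cvgM.
  apply: cvgM; first exact: cvg_cst.
  by apply: cvgB; [exact: cvg_intermediate_velocity|exact: cvg_cst].
apply: cvgV; first by rewrite subr0 oner_eq0.
by apply: cvgB; [exact: cvg_cst|exact: cvg_scaled_density].
Qed.

Let density_neq (AB : R * R) : Num.max rl rr < rs AB ->
  [/\ rs AB != 0, rs AB - rl != 0 & rs AB - rr != 0].
Proof.
rewrite gt_max => /andP[ls rs'].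
by rewrite !gt_eqF ?subr_gt0//; exact: lt_trans ls.
Qed.

Lemma cvg_shock_speed1 : shock_speed rl ul (rs AB) (vs AB) @[AB --> V] --> s0.
Proof.
rewrite -[s0]addr0 -(mul0r (rl * (s0 - ul))).
apply: (@cvg_trans _ ((fun AB => vs AB + (rs AB)^-1 *
    (rl * (vs AB - ul) / (1 - rl * (rs AB)^-1))) @ V)).
  apply: near_eq_cvg; near=> AB.
  have /density_neq[s0' sl sr] : Num.max rl rr < rs AB.
    by near: AB; apply: filterS jumps => ? [].
  by rewrite /shock_speed; field; rewrite s0' sl.
apply: cvgD; first exact: cvg_intermediate_velocity.
by apply: cvgM; [exact: cvg_intermediate_density|exact: cvg_deviation].
Unshelve. all: by end_near. Qed.

Lemma cvg_shock_speed2 : shock_speed (rs AB) (vs AB) rr ur @[AB --> V] --> s0.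
Proof.
rewrite -[s0]addr0 -(mul0r (rr * (s0 - ur))).
apply: (@cvg_trans _ ((fun AB => vs AB + (rs AB)^-1 *
    (rr * (vs AB - ur) / (1 - rr * (rs AB)^-1))) @ V)).
  apply: near_eq_cvg; near=> AB.
  have /density_neq[s0' sl sr] : Num.max rl rr < rs AB.
    by near: AB; apply: filterS jumps => ? [].
  by rewrite /shock_speed; field; rewrite s0' sr -opprB oppr_eq0 sr.
apply: cvgD; first exact: cvg_intermediate_velocity.
by apply: cvgM; [exact: cvg_intermediate_density|exact: cvg_deviation].
Unshelve. all: by end_near. Qed.

Lemma cvg_intermediate_mass :
  rs AB * (shock_speed (rs AB) (vs AB) rr ur
           - shock_speed rl ul (rs AB) (vs AB)) @[AB --> V] -->
  Num.sqrt (rl * rr) * (ul - ur).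
Proof.
(* The right side is the rate at which mass enters a front of speed [s0] from both sides. *)
have -> : Num.sqrt (rl * rr) * (ul - ur) = rr * (s0 - ur) - rl * (s0 - ul).
  rewrite sqrtrM ?ltW// /sigma0.
  have aa : Num.sqrt rl ^+ 2 = rl by rewrite sqr_sqrtr// ltW.
  have bb : Num.sqrt rr ^+ 2 = rr by rewrite sqr_sqrtr// ltW.
  rewrite -[in X in _ = _ - X * _]aa -[in X in _ = X * _ - _]bb; field.
  by rewrite gt_eqF// addr_gt0// sqrtr_gt0.
apply: (@cvg_trans _ ((fun AB => rr * (vs AB - ur) / (1 - rr * (rs AB)^-1)
    - rl * (vs AB - ul) / (1 - rl * (rs AB)^-1)) @ V)).
  apply: near_eq_cvg; near=> AB.
  have /density_neq[s0' sl sr] : Num.max rl rr < rs AB.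
    by near: AB; apply: filterS jumps => ? [].
  by rewrite /shock_speed; field; rewrite s0' sl sr -opprB oppr_eq0 sr.
by apply: cvgB; exact: cvg_deviation.
Unshelve. all: by end_near. Qed.

Lemma cvg_intermediate_pressure :
  P AB (rs AB) * (shock_speed (rs AB) (vs AB) rr ur
                  - shock_speed rl ul (rs AB) (vs AB)) @[AB --> V] --> 0.
Proof.
(* The intermediate pressure itself tends to [rl * (ul - s0) ^+ 2], by the left jump relation; the
   product vanishes because the two speeds merge. *)
have -> : 0 = (0 + (ul - s0) * (rl * (s0 - ul)) * -1) * (s0 - s0).
  by rewrite subrr mulr0.
apply: cvgM; last first.
  by apply: cvgB; [exact: cvg_shock_speed2|exact: cvg_shock_speed1].
apply: (@cvg_trans _ ((fun AB => P AB rl + (ul - vs AB) *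
    (rl * (vs AB - ul) / (1 - rl * (rs AB)^-1)) * -1) @ V)).
  apply: near_eq_cvg; near=> AB.
  have /density_neq[s0' sl _] : Num.max rl rr < rs AB.
    by near: AB; apply: filterS jumps => ? [].
  have [_ _ el _] : squared_jumps AB.
    by near: AB; exact: velocity_jump_sqr.
  have -> : (ul - vs AB) * (rl * (vs AB - ul) / (1 - rl * (rs AB)^-1)) * -1 =
    (ul - vs AB) ^+ 2 * (rl / (1 - rl * (rs AB)^-1)) by ring.
  by rewrite el; field; rewrite s0' sl gt_eqF.
apply: cvgD; first exact: cvg_pressure.
apply: cvgM; last exact: cvg_cst.
apply: cvgM; last exact: cvg_deviation.
by apply: cvgB; [exact: cvg_cst|exact: cvg_intermediate_velocity].
Unshelve. all: by end_near. Qed.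

End asymptotics.

(** * Convergence of the two-shock solutions *)

Section limit.
Context (R : realType) (beta n alpha rl ul rr ur : R).
Context (rs vs : R * R -> R) (x1 x2 : R * R -> R -> R).
Context (rho u : R * R -> R -> R -> R).
Hypotheses (hn : 0 <= n) (ha : 0 <= alpha) (hrl : 0 < rl) (hrr : 0 < rr)
  (hu : ur < ul).
Notation V := (vanishing R).
Notation P := (fun AB : R * R => pressure AB.1 AB.2 n alpha).
Notation X := (delta_position beta rl ul rr ur).
Notation w := (delta_weight rl ul rr ur).
Notation ud := (delta_velocity beta rl ul rr ur).
Hypothesis sol : \forall AB \near V,
  two_shock_solution (P AB) beta rl ul rr ur (rs AB) (vs AB) (x1 AB) (x2 AB)
    (rho AB) (u AB).

#[local] Instance vanishing_proper : ProperFilter V.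
Proof. exact: filter_prod_proper. Qed.

Let s1 AB := shock_speed rl ul (rs AB) (vs AB).
Let s2 AB := shock_speed (rs AB) (vs AB) rr ur.
Let curve (s t : R) := s * t + 2^-1 * beta * t ^+ 2.

Let jumps : \forall AB \near V,
  [/\ Num.max rl rr < rs AB, vs AB - ul = velocity_jump (P AB) rl (rs AB) &
      ur - vs AB = velocity_jump (P AB) (rs AB) rr].
Proof. by apply: filterS sol => AB [_ ? [? ?] _ _]. Qed.

Let cvg_vs : vs AB @[AB --> V] --> sigma0 rl ul rr ur.
Proof. exact: (cvg_intermediate_velocity hn ha hrl hrr hu jumps). Qed.

Let cvg_s1 : s1 AB @[AB --> V] --> sigma0 rl ul rr ur.
Proof. exact: (cvg_shock_speed1 hn ha hrl hrr hu jumps). Qed.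

Let cvg_s2 : s2 AB @[AB --> V] --> sigma0 rl ul rr ur.
Proof. exact: (cvg_shock_speed2 hn ha hrl hrr hu jumps). Qed.

Let x1E : \forall AB \near V, forall t, 0 < t -> x1 AB t = curve (s1 AB) t.
Proof.
by apply: filterS sol => AB [_ _ _ [path _] _]; exact: path_from_0_affine path.
Qed.

Let x2E : \forall AB \near V, forall t, 0 < t -> x2 AB t = curve (s2 AB) t.
Proof.
by apply: filterS sol => AB [_ _ _ [_ path] _]; exact: path_from_0_affine path.
Qed.

(** The order of the shocks is read off the limit: [rs * (s2 - s1)] tends to a positive number. *)
Let le_s12 : \forall AB \near V, s1 AB <= s2 AB.
Proof.
near=> AB.
have : Num.max rl rr < rs AB by near: AB; apply: filterS jumps => ? [].
rewrite gt_max => /andP[/(lt_trans hrl) rs0 _].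
rewrite -subr_ge0 -(pmulr_rge0 _ rs0) ltW//.
near: AB; apply: (cvgr_gt _ (cvg_intermediate_mass hn ha hrl hrr hu jumps)).
by rewrite mulr_gt0 ?sqrtr_gt0 ?mulr_gt0// subr_gt0.
Unshelve. all: by end_near. Qed.

Let continuous_curve s : continuous (curve s).
Proof.
move=> t; apply: cvgD; first by apply: cvgM; [exact: cvg_cst|exact: cvg_id].
by apply: cvgM; [exact: cvg_cst|exact: exprn_continuous].
Qed.

Let continuous_velocity (v : R) k : continuous (fun t => (v + beta * t) ^+ k).
Proof.
move=> t; apply: (continuous_cvg _ (@exprn_continuous _ k _)).
apply: cvgD; first exact: cvg_cst.
by apply: cvgM; [exact: cvg_cst|exact: cvg_id].
Qed.

Let continuous_momentum (a v : R) k :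
  continuous (fun t => a * (v + beta * t) ^+ k).
Proof.
by move=> t; apply: cvgM; [exact: cvg_cst|exact: continuous_velocity].
Qed.

Let continuous_flux (a v c : R) k :
  continuous (fun t => a * (v + beta * t) ^+ k + c).
Proof.
by move=> t; apply: cvgD; [exact: continuous_momentum|exact: cvg_cst].
Qed.

(* For [k = 2] and [c = 1] this is the momentum flux of the gas. *)
Let density (c : R) (k : nat) (AB : R * R) (x t : R) : R :=
  rho AB x t * u AB x t ^+ k + c * P AB (rho AB x t).

Let three_states_density c k : \forall AB \near V,
  three_states (curve (s1 AB)) (curve (s2 AB))
    (fun t => rl * (ul + beta * t) ^+ k + c * P AB rl)
    (fun t => rs AB * (vs AB + beta * t) ^+ k + c * P AB (rs AB))
    (fun t => rr * (ur + beta * t) ^+ k + c * P AB rr)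
    (density c k AB).
Proof.
near=> AB; split.
  by split; [exact: continuous_curve|exact: continuous_curve
    |exact: continuous_flux|exact: continuous_flux|exact: continuous_flux].
move=> x t t0.
have [_ _ _ _ /(_ x t t0)[Hl Hm Hr]] : two_shock_solution (P AB) beta rl ul
    rr ur (rs AB) (vs AB) (x1 AB) (x2 AB) (rho AB) (u AB) by near: AB.
rewrite -(near x1E AB)// -(near x2E AB)//; rewrite /density; split.
- rewrite (near x1E AB)// (near x2E AB)// lerD2r ler_pM2r//.
  by near: AB.
- by move=> /Hl[-> ->].
- by move=> /Hm[-> ->].
- by move=> /Hr[-> ->].
Unshelve. all: by end_near. Qed.

Let cvg_density c k psi : test_function psi ->
  pairing (density c k AB) psi @[AB --> V] -->
  delta_pairing beta rl ul rr ur X w ud k psi.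
Proof.
move=> tpsi; have [b psi0] := test_function_support tpsi.
apply: (cvg_pairing (test_function_continuous tpsi) psi0 _
  (three_states_density c k) (m0 := fun t => w t * ud t ^+ k)).
- exact: continuous_curve.
- exact: continuous_momentum.
- exact: continuous_momentum.
- move=> t; apply: cvgM; last exact: continuous_velocity.
  by apply: cvgM; [exact: cvg_cst|exact: cvg_id].
move=> t G.
have lift (f : R * R -> R) (a : R) : f @ V --> a -> f p.1 @[p --> G] --> a.
  by move=> fa; apply: (cvg_comp _ _ (cvg_fst)); exact: fa.
have tG : p.2 @[p --> G] --> t by exact: cvg_snd.
have cvg_curve s : s @ V --> sigma0 rl ul rr ur ->
    curve (s p.1) p.2 @[p --> G] --> X t.
  move=> sG; apply: cvgD; first by apply: cvgM => //; exact: lift.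
  apply: cvgM; first exact: cvg_cst.
  by apply: (continuous_cvg _ (@exprn_continuous _ 2 t)).
have cvg_pow v v0 : v @ V --> v0 ->
    (v p.1 + beta * p.2) ^+ k @[p --> G] --> (v0 + beta * t) ^+ k.
  move=> vG; apply: (continuous_cvg _ (@exprn_continuous _ k _)).
  apply: cvgD; first exact: lift.
  by apply: cvgM => //; exact: cvg_cst.
have cvg_side r v :
    r * (v + beta * p.2) ^+ k + c * P p.1 r @[p --> G] -->
    r * (v + beta * t) ^+ k.
  have -> : r * (v + beta * t) ^+ k = r * (v + beta * t) ^+ k + c * 0.
    by rewrite mulr0 addr0.
  apply: cvgD.
    apply: cvgM; first exact: cvg_cst.
    by apply: (cvg_pow (cst v)); exact: cvg_cst.
  apply: cvgM; first exact: cvg_cst.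
  by apply: (lift (fun AB => P AB r)); exact: cvg_pressure.
split; [exact: cvg_curve|exact: cvg_curve|exact: cvg_side| |exact: cvg_side].
have -> : w t * ud t ^+ k = Num.sqrt (rl * rr) * (ul - ur) * t * ud t ^+ k
    + c * (0 * t) by rewrite mul0r mulr0 addr0.
(* The friction terms of the two parabolas cancel, so the zone has width [(s2 - s1) * t], which is
   paired with the density and with the pressure. *)
have -> : (fun p => (rs p.1 * (vs p.1 + beta * p.2) ^+ k + c * P p.1 (rs p.1))
      * (curve (s2 p.1) p.2 - curve (s1 p.1) p.2)) =
    fun p => (rs p.1 * (s2 p.1 - s1 p.1)) * p.2 * (vs p.1 + beta * p.2) ^+ k
      + c * ((P p.1 (rs p.1) * (s2 p.1 - s1 p.1)) * p.2).
  by apply/funext => p; rewrite /curve; ring.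
apply: cvgD.
  apply: cvgM; last exact: cvg_pow.
  apply: cvgM => //; apply: (lift (fun AB => rs AB * (s2 AB - s1 AB))).
  exact: (cvg_intermediate_mass hn ha hrl hrr hu jumps).
apply: cvgM; first exact: cvg_cst.
apply: cvgM => //.
apply: (lift (fun AB => P AB (rs AB) * (s2 AB - s1 AB))).
exact: (cvg_intermediate_pressure hn ha hrl hrr hu jumps).
Qed.

Let cvg_densityE c k (g : R * R -> R -> R -> R) psi :
  (forall AB x t, g AB x t = density c k AB x t) -> test_function psi ->
  pairing (g AB) psi @[AB --> V] -->
  delta_pairing beta rl ul rr ur X w ud k psi.
Proof.
move=> gE; have -> : g = density c k; last exact: cvg_density.
by apply/funext => AB; apply/funext => x; apply/funext => t; exact: gE.
Qed.

Lemma cvg_moment k psi : test_function psi ->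
  pairing (fun x t => rho AB x t * u AB x t ^+ k) psi @[AB --> V] -->
  delta_pairing beta rl ul rr ur X w ud k psi.
Proof. by apply: (@cvg_densityE 0) => AB x t; rewrite /density mul0r addr0. Qed.

Lemma delta_shock_two_shock_limit :
  delta_shock_solution beta rl ul rr ur X w ud.
Proof.
split.
- split; first by rewrite /delta_position expr0n/= !mulr0 addr0.
    exact/continuous_subspaceT/continuous_curve.
  by move=> t _; exact: is_derive_parabola.
- by rewrite /delta_weight mulr0.
(* The entropy condition holds because [sigma0] is a mean of [ul] and [ur] with positive weights. *)
- move=> t _; rewrite !ltrD2r /sigma0.
  have a0 : 0 < Num.sqrt rl by rewrite sqrtr_gt0.
  have b0 : 0 < Num.sqrt rr by rewrite sqrtr_gt0.
  rewrite ltr_pdivlMr ?ltr_pdivrMr ?addr_gt0// !mulrDr.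
  by rewrite ![_ * Num.sqrt _]mulrC ltrD2r ltrD2l !ltr_pM2l// hu.
move=> psi tpsi.
have tdt : test_function (dt psi) by exact: test_function_derive.
have tdx : test_function (dx psi) by exact: test_function_derive.
have momentum psi' : test_function psi' ->
    pairing (fun x t => rho AB x t * u AB x t) psi' @[AB --> V] -->
    delta_pairing beta rl ul rr ur X w ud 1 psi'.
  by apply: (@cvg_densityE 0) => AB x t; rewrite /density mul0r addr0 expr1.
have mass psi' : test_function psi' -> pairing (rho AB) psi' @[AB --> V] -->
    delta_pairing beta rl ul rr ur X w ud 0 psi'.
  apply: (@cvg_densityE 0) => AB x t.
  by rewrite /density mul0r addr0 expr0 mulr1.
have flux : pairing (fun x t => rho AB x t * u AB x t ^+ 2 + P AB (rho AB x t))
    (dx psi) @[AB --> V] --> delta_pairing beta rl ul rr ur X w ud 2 (dx psi).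
  by apply: (@cvg_densityE 1) => // AB x t; rewrite /density mul1r.
have weak : \forall AB \near V, weak_solution (P AB) beta (rho AB) (u AB).
  by apply: filterS sol => AB [[]].
split.
  apply: (near_eq_lim _ (cvgD (mass _ tdt) (momentum _ tdx)) (cvg_cst 0)).
  by apply: filterS weak => AB /(_ psi tpsi)[e _]; exact: e.
apply: (near_eq_lim _ (cvgD (momentum _ tdt) flux)
  (cvgN (cvgM (cvg_cst beta) (mass _ tpsi)))).
near=> AB.
have /(_ psi tpsi)[_ e] : weak_solution (P AB) beta (rho AB) (u AB).
  by near: AB.
have [b psi0] := test_function_support tpsi.
(* The density has three states too, which allows [beta] to leave the friction pairing. *)
have densE : density 0 0 AB = rho AB.
  apply/funext => x; apply/funext => t.
  by rewrite /density expr0 mulr1 mul0r addr0.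
have ts : three_states (curve (s1 AB)) (curve (s2 AB))
    (fun t => rl * (ul + beta * t) ^+ 0 + 0 * P AB rl)
    (fun t => rs AB * (vs AB + beta * t) ^+ 0 + 0 * P AB (rs AB))
    (fun t => rr * (ur + beta * t) ^+ 0 + 0 * P AB rr) (rho AB).
  by rewrite -densE; near: AB; exact: three_states_density.
transitivity (- pairing (fun x t => beta * rho AB x t) psi); first exact: e.
exact: (congr1 -%R (pairingZ_three_states (test_function_continuous tpsi) psi0
  beta ts)).
Unshelve. all: by end_near. Qed.

Let cvg_position (s : R * R -> R) (x : R * R -> R -> R) (t : R) :
  s @ V --> sigma0 rl ul rr ur ->
  (\forall AB \near V, forall t, 0 < t -> x AB t = curve (s AB) t) -> 0 < t ->
  x AB t @[AB --> V] --> X t.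
Proof.
move=> sV xE t0; apply: (@cvg_trans _ ((fun AB => curve (s AB) t) @ V)).
  by apply: near_eq_cvg; apply: filterS xE => AB /(_ t t0).
apply: cvgD; last exact: cvg_cst.
by apply: cvgM => //; exact: cvg_cst.
Qed.

Lemma cvg_shock1 t : 0 < t -> x1 AB t @[AB --> V] --> X t.
Proof. exact: cvg_position cvg_s1 x1E. Qed.

Lemma cvg_shock2 t : 0 < t -> x2 AB t @[AB --> V] --> X t.
Proof. exact: cvg_position cvg_s2 x2E. Qed.

Lemma cvg_intermediate_speed t : vs AB + beta * t @[AB --> V] --> ud t.
Proof. by apply: cvgD => //; exact: cvg_cst. Qed.

(** Both shocks tend to [X t], so a point off [X t] eventually lies outside the intermediate zone,
    on a fixed side, where [u] no longer depends on [AB]. *)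
Lemma cvg_velocity x t : 0 < t -> x != X t ->
  u AB x t @[AB --> V] -->
  step X (fun t => ul + beta * t) (fun t => ur + beta * t) x t.
Proof.
move=> t0 xX; rewrite /step.
have states : \forall AB \near V,
    (x < x1 AB t -> u AB x t = ul + beta * t) /\
    (x2 AB t < x -> u AB x t = ur + beta * t).
  apply: filterS sol => AB [_ _ _ _ /(_ x t t0)[Hl _ Hr]].
  by split=> [/Hl|/Hr] [].
case: (ltgtP x (X t)) xX => // xX _.
  apply: (@cvg_trans _ ((fun=> ul + beta * t) @ V)); last exact: cvg_cst.
  apply: near_eq_cvg; near=> AB.
  have [-> //] : (x < x1 AB t -> u AB x t = ul + beta * t) /\
    (x2 AB t < x -> u AB x t = ur + beta * t) by near: AB.
  by near: AB; apply: (cvgr_gt _ (cvg_shock1 t0)).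
apply: (@cvg_trans _ ((fun=> ur + beta * t) @ V)); last exact: cvg_cst.
apply: near_eq_cvg; near=> AB.
have [_ -> //] : (x < x1 AB t -> u AB x t = ul + beta * t) /\
  (x2 AB t < x -> u AB x t = ur + beta * t) by near: AB.
by near: AB; apply: (cvgr_lt _ (cvg_shock2 t0)).
Unshelve. all: by end_near. Qed.

End limit.

Theorem theorem5p1 (R : realType) (beta n alpha rl ul rr ur : R)
    (hn : 1 <= n <= 3) (halpha : 0 < alpha <= 1)
    (hrl : 0 < rl) (hrr : 0 < rr) (hu : ur < ul)
    (rs vs : R -> R -> R) (x1 x2 : R -> R -> R -> R)
    (rho u : R -> R -> R -> R -> R)
    (hsol : forall A B : R, 0 < A -> 0 < B ->
      region_IV (pressure A B n alpha) rl ul (rr, ur) ->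
      two_shock_solution (pressure A B n alpha) beta rl ul rr ur
        (rs A B) (vs A B) (x1 A B) (x2 A B) (rho A B) (u A B)) :
  let X := delta_position beta rl ul rr ur in
  let w := delta_weight rl ul rr ur in
  let ud := delta_velocity beta rl ul rr ur in
  delta_shock_solution beta rl ul rr ur X w ud /\
  converges_to_delta_shock beta rl ul rr ur vs x1 x2 rho u X w ud.
Proof.
move=> X w ud.
have hn0 : 0 <= n by case/andP: hn => n1 _; exact: le_trans n1.
have ha0 : 0 <= alpha by case/andP: halpha => /ltW.
pose uncurry2 T (f : R -> R -> T) (AB : R * R) := f AB.1 AB.2.
have sol : \forall AB \near vanishing R,
    two_shock_solution (pressure AB.1 AB.2 n alpha) beta rl ul rr ur
      (uncurry2 _ rs AB) (uncurry2 _ vs AB) (uncurry2 _ x1 AB)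
      (uncurry2 _ x2 AB) (uncurry2 _ rho AB) (uncurry2 _ u AB).
  (* Solutions are given only for positive parameters with the right state in region IV; both
     conditions hold near the limit. *)
  near=> AB.
  have [A0 B0] : 0 < AB.1 /\ 0 < AB.2 by near: AB; exact: vanishing_gt0.
  by apply: hsol => //; near: AB; exact: near_region_IV.
split; first exact: delta_shock_two_shock_limit sol.
split=> [k psi _|x t|t|t|t _].
- exact: cvg_moment sol _ _.
- exact: cvg_velocity sol _ _.
- exact: cvg_shock1 sol _.
- exact: cvg_shock2 sol _.
- exact: cvg_intermediate_speed sol _.
Unshelve. all: by end_near. Qed.
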